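(* Let $C$ be a skeletal Rees category and let $U(C)$ be its universal groupoid, with canonical functor $\iota\colon C\to U(C)$. Then $C$ embeds in $U(C)$ via $\iota$; that is, $\iota$ is injective on arrows.
   Context: Categories are small and viewed as sets of arrows, with objects replaced by identity arrows; $C_o$ is the set of identities of $C$. Each arrow $a$ has a domain $\mathbf{d}(a)$ and a codomain $\mathbf{r}(a)$ (both identities), $a=\mathbf{d}(a)a=a\mathbf{r}(a)$, and $ab$ is defined iff $\mathbf{r}(a)=\mathbf{d}(b)$. A category is left cancellative if $ax=ay$ implies $x=y$; right cancellative is dual. A principal right ideal is a set $aC=\{ac : c\in C,\ ac \text{ defined}\}$. $C$ is right rigid if $aC\cap bC\neq\emptyset$ implies $aC\subseteq bC$ or $bC\subseteq aC$. A left Rees category is a left cancellative, right rigid category in which each principal right ideal is properly contained in only finitely many distinct principal right ideals. A Rees category is a left Rees category that is also right cancellative. A category is skeletal if every invertible arrow $a$ satisfies $\mathbf{d}(a)=\mathbf{r}(a)$. The universal groupoid $U(C)$: regard $C$ as a directed graph (vertices $C_o$, edges the arrows), adjoin for each arrow $a\colon e\to f$ a new edge $a^{-1}\colon f\to e$, form the free category $(C\cup C^{-1})^{*}$ of finite directed paths (with concatenation written $\cdot$), and quotient by the congruence generated by $a\cdot a^{-1}\equiv\mathbf{d}(a)$, $a^{-1}\cdot a\equiv\mathbf{r}(a)$ (where an identity on the right-hand side denotes the empty path at that vertex) and $a\cdot b\equiv ab$ whenever $ab$ is defined in $C$ ($a,b\in C$). The functor $\iota\colon C\to U(C)$ sends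 $a$ to the class of the path $a$; it is universal among functors from $C$ to groupoids. *)

(* Defs.v *)
From HB Require Import structures.
From mathcomp Require Import all_boot.
From mathcomp Require Import generic_quotient.
From mathcomp Require Import boolp classical_sets functions cardinality.

Set Implicit Arguments.
Unset Strict Implicit.
Unset Printing Implicit Defensive.

Local Open Scope classical_set_scope.
Local Open Scope quotient_scope.

(* Small categories as sets of arrows, in diagrammatic order: the identities
   are the fixed points of dom, and the product a b is defined when
   cod a = dom b.  The partial product is represented by a total function whose
   values on non-composable pairs are irrelevant. *)
Record category := Category {
  arrow :> Type;
  dom : arrow -> arrow;
  cod : arrow -> arrow;
  mul : arrow -> arrow -> arrow;
  dom_dom : forall a, dom (dom a) = dom a;
  cod_dom : forall a, cod (dom a) = dom a;
  dom_cod : forall a, dom (cod a) = cod a;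
  cod_cod : forall a, cod (cod a) = cod a;
  mul_dom : forall a, mul (dom a) a = a;
  mul_cod : forall a, mul a (cod a) = a;
  dom_mul : forall a b, cod a = dom b -> dom (mul a b) = dom a;
  cod_mul : forall a b, cod a = dom b -> cod (mul a b) = cod b;
  mulA : forall a b c, cod a = dom b -> cod b = dom c ->
    mul a (mul b c) = mul (mul a b) c
}.

HB.instance Definition _ (C : category) := gen_eqMixin (arrow C).
HB.instance Definition _ (C : category) := gen_choiceMixin (arrow C).

Record functor (C D : category) := Functor {
  fmap :> C -> D;
  fmap_dom : forall a, fmap (dom a) = dom (fmap a);
  fmap_cod : forall a, fmap (cod a) = cod (fmap a);
  fmap_mul : forall a b, cod a = dom b ->
    fmap (mul a b) = mul (fmap a) (fmap b)
}.

Definition inverse_of (C : category) (a b : C) : Prop :=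
  [/\ cod a = dom b, cod b = dom a, mul a b = dom a & mul b a = cod a].

Definition invertible (C : category) (a : C) : Prop :=
  exists b, inverse_of a b.

Definition groupoid (C : category) : Prop := forall a : C, invertible a.

Lemma invertible_dom (C : category) (a : C) : invertible (dom a).
Proof.
by exists (dom a); split; rewrite ?cod_dom ?dom_dom // -{1}dom_dom mul_dom.
Qed.

Lemma invertible_mul (C : category) (a b : C) : cod a = dom b ->
  invertible a -> invertible b -> invertible (mul a b).
Proof.
move=> ab [a' [aa' a'a ea ea']] [b' [bb' b'b eb eb']].
have b'a' : cod b' = dom a' by rewrite b'b -ab.
exists (mul b' a'); split; rewrite ?(dom_mul, cod_mul) //.
- rewrite mulA ?(dom_mul, cod_mul) // -(mulA ab bb') eb -ab mul_cod //.
- rewrite mulA ?(dom_mul, cod_mul) // -(mulA b'a' a'a) ea' ab -b'b mul_cod //.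
Qed.

Lemma inverse_of_uniq (C : category) (a b c : C) :
  inverse_of a b -> inverse_of a c -> b = c.
Proof.
move=> [ab ba e1 e2] [ac ca e3 e4].
by rewrite -[LHS]mul_cod ba -e3 mulA // e2 ac mul_dom.
Qed.

Lemma fmap_inverse (C D : category) (F : functor C D) (a b : C) :
  inverse_of a b -> inverse_of (F a) (F b).
Proof.
move=> [ab ba e1 e2].
by split; rewrite -?fmap_mul // -?fmap_dom -?fmap_cod ?ab ?ba ?e1 ?e2 ?ab.
Qed.

Definition left_cancellative (C : category) : Prop :=
  forall a x y : C, cod a = dom x -> cod a = dom y -> mul a x = mul a y ->
    x = y.

Definition right_cancellative (C : category) : Prop :=
  forall a x y : C, cod x = dom a -> cod y = dom a -> mul x a = mul y a ->
    x = y.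

Definition pr_ideal (C : category) (a : C) : set C :=
  [set x | exists2 c, cod a = dom c & x = mul a c].

Definition right_rigid (C : category) : Prop :=
  forall a b : C, pr_ideal a `&` pr_ideal b !=set0 ->
    pr_ideal a `<=` pr_ideal b \/ pr_ideal b `<=` pr_ideal a.

Definition left_rees (C : category) : Prop :=
  [/\ left_cancellative C, right_rigid C &
      forall a : C,
        finite_set [set I | range (@pr_ideal C) I /\ pr_ideal a `<` I]].

Definition rees (C : category) : Prop :=
  left_rees C /\ right_cancellative C.

Definition skeletal (C : category) : Prop :=
  forall a : C, invertible a -> dom a = cod a.

(* The free category of a directed graph: a path is a starting vertex together
   with a finite, possibly empty, list of consecutive edges. *)
Record graph := Graph {
  vertex : choiceType;
  edge : choiceType;
  src : edge -> vertex;
  tgt : edge -> vertex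
}.

Section FreeCategory.
Variable Q : graph.
Implicit Types (x : vertex Q) (s t : seq (edge Q)).

Fixpoint walk x s : bool :=
  if s is e :: s' then (src e == x) && walk (tgt e) s' else true.

Definition endpoint x s : vertex Q := last x (map (@tgt Q) s).

Definition gpath := {p : vertex Q * seq (edge Q) | walk p.1 p.2}.

Implicit Types p q : gpath.

Definition gstart p : vertex Q := (val p).1.
Definition gedges p : seq (edge Q) := (val p).2.
Definition gend p : vertex Q := endpoint (gstart p) (gedges p).

Definition gempty x : gpath := exist _ (x, [::]) isT.

Lemma walk_edge (e : edge Q) : walk (src e) [:: e].
Proof. by rewrite /= eqxx. Qed.

Definition gedge (e : edge Q) : gpath := exist _ (src e, [:: e]) (walk_edge e).

(* Concatenation; when the endpoints do not match, the raw concatenation is not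
   a path and insubd returns the irrelevant value p. *)
Definition gcat p q : gpath := insubd p (gstart p, gedges p ++ gedges q).

Lemma walk_cat x s t : walk x (s ++ t) = walk x s && walk (endpoint x s) t.
Proof. by elim: s x => //= e s IH x; rewrite IH andbA. Qed.

Lemma endpoint_cat x s t : endpoint x (s ++ t) = endpoint (endpoint x s) t.
Proof. by rewrite /endpoint map_cat last_cat. Qed.

Lemma val_gcat p q : gend p = gstart q ->
  val (gcat p q) = (gstart p, gedges p ++ gedges q).
Proof.
move=> pq; rewrite val_insubd /= walk_cat (valP p) -/(gend p) pq.
by rewrite (valP q).
Qed.

Lemma gempty_inj : injective gempty.
Proof. by move=> x y [->]. Qed.

Lemma gpathP p q : gstart p = gstart q -> gedges p = gedges q -> p = q.
Proof.
move=> h1 h2; apply: val_inj.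
by rewrite [LHS]surjective_pairing [RHS]surjective_pairing; congr pair.
Qed.

Lemma gstart_cat p q : gend p = gstart q -> gstart (gcat p q) = gstart p.
Proof. by move=> pq; rewrite /gstart val_gcat. Qed.

Lemma gedges_cat p q : gend p = gstart q ->
  gedges (gcat p q) = gedges p ++ gedges q.
Proof. by move=> pq; rewrite /gedges val_gcat. Qed.

Lemma gend_cat p q : gend p = gstart q -> gend (gcat p q) = gend q.
Proof.
move=> pq; rewrite /gend gstart_cat // gedges_cat // endpoint_cat -/(gend p).
by rewrite pq.
Qed.

Fact free_mul_dom p : gcat (gempty (gstart p)) p = p.
Proof. by apply: gpathP; rewrite ?gstart_cat ?gedges_cat. Qed.

Fact free_mul_cod p : gcat p (gempty (gend p)) = p.
Proof. by apply: gpathP; rewrite ?gstart_cat ?gedges_cat ?cats0. Qed.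

Fact free_dom_mul p q : gempty (gend p) = gempty (gstart q) ->
  gempty (gstart (gcat p q)) = gempty (gstart p).
Proof. by move/gempty_inj=> pq; rewrite gstart_cat. Qed.

Fact free_cod_mul p q : gempty (gend p) = gempty (gstart q) ->
  gempty (gend (gcat p q)) = gempty (gend q).
Proof. by move/gempty_inj=> pq; rewrite gend_cat. Qed.

Fact free_mulA p q r : gempty (gend p) = gempty (gstart q) ->
  gempty (gend q) = gempty (gstart r) ->
  gcat p (gcat q r) = gcat (gcat p q) r.
Proof.
move=> /gempty_inj pq /gempty_inj qr.
have pqr : gend p = gstart (gcat q r) by rewrite gstart_cat.
have pqr' : gend (gcat p q) = gstart r by rewrite gend_cat.
by apply: gpathP; rewrite ?gstart_cat ?gedges_cat ?catA.
Qed.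

Definition free_category : category :=
  @Category gpath (fun p => gempty (gstart p)) (fun p => gempty (gend p)) gcat
    (fun=> erefl) (fun=> erefl) (fun=> erefl) (fun=> erefl)
    free_mul_dom free_mul_cod free_dom_mul free_cod_mul free_mulA.

Lemma gpath_ind (P : gpath -> Prop) : (forall x, P (gempty x)) ->
  (forall e q, tgt e = gstart q -> P q -> P (gcat (gedge e) q)) ->
  forall p, P p.
Proof.
move=> P0 PS [[x s] /= ws].
elim: s x ws => [|e s IH] x ws.
  by rewrite (_ : exist _ _ _ = gempty x) //; apply: val_inj.
have /andP[/eqP ex ws'] := ws.
set q : gpath := exist _ (tgt e, s) ws'.
rewrite (_ : exist _ _ _ = gcat (gedge e) q); first exact/PS/IH.
apply: val_inj; rewrite val_gcat //.
by rewrite /gedges /gstart /= ex.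
Qed.

Section Lift.
Variables (D : category) (fV : vertex Q -> D) (fE : edge Q -> D).
Hypothesis dom_fV : forall x, dom (fV x) = fV x.
Hypothesis dom_fE : forall e, dom (fE e) = fV (src e).
Hypothesis cod_fE : forall e, cod (fE e) = fV (tgt e).

Let cod_fV x : cod (fV x) = fV x.
Proof. by rewrite -dom_fV cod_dom. Qed.

Fixpoint gval x s : D :=
  if s is e :: s' then mul (fE e) (gval (tgt e) s') else fV x.

Lemma dom_gval x s : walk x s -> dom (gval x s) = fV x.
Proof.
elim: s x => [|e s IH] x /=; first by rewrite dom_fV.
by move=> /andP[/eqP <- ws]; rewrite dom_mul ?dom_fE // IH ?cod_fE.
Qed.

Lemma cod_gval x s : walk x s -> cod (gval x s) = fV (endpoint x s).
Proof.
elim: s x => [|e s IH] x /=; first by rewrite cod_fV.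
by move=> /andP[_ ws]; rewrite cod_mul ?cod_fE ?dom_gval // IH.
Qed.

Lemma gval_cat x s t : walk x s -> walk (endpoint x s) t ->
  gval x (s ++ t) = mul (gval x s) (gval (endpoint x s) t).
Proof.
elim: s x => [|e s IH] x /=.
  by move=> _ wt; rewrite -{1}(dom_gval wt) mul_dom.
move=> /andP[_ ws] wt; rewrite IH // mulA //.
- by rewrite cod_fE dom_gval.
- by rewrite cod_gval ?dom_gval.
Qed.

Definition free_eval (p : free_category) : D := gval (gstart p) (gedges p).

Fact free_eval_dom (p : free_category) : free_eval (dom p) = dom (free_eval p).
Proof. by rewrite /free_eval dom_gval //; apply: (valP p). Qed.

Fact free_eval_cod (p : free_category) : free_eval (cod p) = cod (free_eval p).
Proof. by rewrite /free_eval cod_gval //; apply: (valP p). Qed.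

Fact free_eval_mul (p q : free_category) : cod p = dom q ->
  free_eval (mul p q) = mul (free_eval p) (free_eval q).
Proof.
move=> /gempty_inj pq; rewrite /free_eval /= gstart_cat // gedges_cat //.
rewrite gval_cat -/(gend p) ?pq //; first exact: (valP p).
exact: (valP q).
Qed.

Definition free_lift : functor free_category D :=
  @Functor free_category D free_eval free_eval_dom free_eval_cod free_eval_mul.

End Lift.

End FreeCategory.

Section QuotientCategory.
Variables (C : category) (R : C -> C -> Prop).
Hypothesis R_parallel : forall a b, R a b -> dom a = dom b /\ cod a = cod b.

Inductive cong : C -> C -> Prop :=
| cong_gen a b : R a b -> cong a b
| cong_refl a : cong a a
| cong_sym a b : cong a b -> cong b a
| cong_trans a b c : cong a b -> cong b c -> cong a c
| cong_mul a a' b b' : cod a = dom b -> cod a' = dom b' ->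
    cong a a' -> cong b b' -> cong (mul a b) (mul a' b').

Lemma cong_parallel a b : cong a b -> dom a = dom b /\ cod a = cod b.
Proof.
elim=> {a b} [a b /R_parallel//|//|a b _ [-> ->]//||].
- by move=> a b c _ [-> ->].
- move=> a a' b b' ab ab' _ [da ca] _ [db cb].
  by rewrite !dom_mul // !cod_mul.
Qed.

Definition congb : rel C := fun a b => `[< cong a b >].

Fact congb_refl : reflexive congb.
Proof. by move=> a; apply/asboolP; apply: cong_refl. Qed.

Fact congb_sym : symmetric congb.
Proof. by move=> a b; apply/asboolP/asboolP; apply: cong_sym. Qed.

Fact congb_trans : transitive congb.
Proof.
by move=> b a c /asboolP ab /asboolP bc; apply/asboolP; apply: cong_trans bc.
Qed.

Canonical congb_equiv := EquivRel congb congb_refl congb_sym congb_trans.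

Definition quot := {eq_quot congb}.

Definition quot_class (a : C) : quot := \pi_quot a.
Definition quot_dom (q : quot) : quot := quot_class (dom (repr q)).
Definition quot_cod (q : quot) : quot := quot_class (cod (repr q)).
Definition quot_mul (q q' : quot) : quot := quot_class (mul (repr q) (repr q')).

Lemma quot_classP a b : quot_class a = quot_class b <-> cong a b.
Proof.
by split=> [/eqmodP /asboolP|ab] //; apply/eqmodP/asboolP.
Qed.

Lemma cong_repr a : cong (repr (quot_class a)) a.
Proof. by apply/quot_classP; rewrite /quot_class reprK. Qed.

Lemma quot_domE a : quot_dom (quot_class a) = quot_class (dom a).
Proof. by rewrite /quot_dom (cong_parallel (cong_repr a)).1. Qed.

Lemma quot_codE a : quot_cod (quot_class a) = quot_class (cod a).
Proof. by rewrite /quot_cod (cong_parallel (cong_repr a)).2. Qed.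

Lemma quot_mulE a b : cod a = dom b ->
  quot_mul (quot_class a) (quot_class b) = quot_class (mul a b).
Proof.
move=> ab; apply/quot_classP; have [[_ ca] [db _]] :=
  (cong_parallel (cong_repr a), cong_parallel (cong_repr b)).
by apply: cong_mul; rewrite ?ca ?db //; apply: cong_repr.
Qed.

Lemma quot_composable a b :
  quot_cod (quot_class a) = quot_dom (quot_class b) -> cod a = dom b.
Proof.
rewrite quot_codE quot_domE => /quot_classP /cong_parallel[].
by rewrite dom_cod dom_dom.
Qed.

Lemma quot_ind (P : quot -> Prop) : (forall a, P (quot_class a)) ->
  forall q, P q.
Proof. by move=> H q; rewrite -[q]reprK; apply: H. Qed.

Fact quot_dom_dom q : quot_dom (quot_dom q) = quot_dom q.
Proof. by elim/quot_ind: q => a; rewrite !quot_domE dom_dom. Qed.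

Fact quot_cod_dom q : quot_cod (quot_dom q) = quot_dom q.
Proof. by elim/quot_ind: q => a; rewrite quot_domE quot_codE cod_dom. Qed.

Fact quot_dom_cod q : quot_dom (quot_cod q) = quot_cod q.
Proof. by elim/quot_ind: q => a; rewrite quot_codE quot_domE dom_cod. Qed.

Fact quot_cod_cod q : quot_cod (quot_cod q) = quot_cod q.
Proof. by elim/quot_ind: q => a; rewrite !quot_codE cod_cod. Qed.

Fact quot_mul_dom q : quot_mul (quot_dom q) q = q.
Proof.
by elim/quot_ind: q => a; rewrite quot_domE quot_mulE ?cod_dom ?mul_dom.
Qed.

Fact quot_mul_cod q : quot_mul q (quot_cod q) = q.
Proof.
by elim/quot_ind: q => a; rewrite quot_codE quot_mulE ?dom_cod ?mul_cod.
Qed.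

Fact quot_dom_mul p q : quot_cod p = quot_dom q ->
  quot_dom (quot_mul p q) = quot_dom p.
Proof.
elim/quot_ind: p => a; elim/quot_ind: q => b /quot_composable ab.
by rewrite quot_mulE // !quot_domE dom_mul.
Qed.

Fact quot_cod_mul p q : quot_cod p = quot_dom q ->
  quot_cod (quot_mul p q) = quot_cod q.
Proof.
elim/quot_ind: p => a; elim/quot_ind: q => b /quot_composable ab.
by rewrite quot_mulE // !quot_codE cod_mul.
Qed.

Fact quot_mulA p q r : quot_cod p = quot_dom q -> quot_cod q = quot_dom r ->
  quot_mul p (quot_mul q r) = quot_mul (quot_mul p q) r.
Proof.
elim/quot_ind: p => a; elim/quot_ind: q => b; elim/quot_ind: r => c.
move=> /quot_composable ab /quot_composable bc.
by rewrite !quot_mulE ?mulA ?dom_mul ?cod_mul.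
Qed.

Definition quotient_category : category :=
  @Category quot quot_dom quot_cod quot_mul
    quot_dom_dom quot_cod_dom quot_dom_cod quot_cod_cod
    quot_mul_dom quot_mul_cod quot_dom_mul quot_cod_mul quot_mulA.

Fact quotient_dom a : quot_class (dom a) = quot_dom (quot_class a).
Proof. by rewrite quot_domE. Qed.

Fact quotient_cod a : quot_class (cod a) = quot_cod (quot_class a).
Proof. by rewrite quot_codE. Qed.

Fact quotient_mul a b : cod a = dom b ->
  quot_class (mul a b) = quot_mul (quot_class a) (quot_class b).
Proof. by move=> ab; rewrite quot_mulE. Qed.

Definition quotient_functor : functor C quotient_category :=
  @Functor C quotient_category quot_class
    quotient_dom quotient_cod quotient_mul.

Section Lift.
Variables (D : category) (F : functor C D).
Hypothesis FR : forall a b, R a b -> F a = F b.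

Lemma fmap_cong a b : cong a b -> F a = F b.
Proof.
elim=> {a b} [a b /FR//|//|a b _ ->//|a b c _ -> _ ->//|].
by move=> a a' b b' ab ab' _ ea _ eb; rewrite !fmap_mul // ea eb.
Qed.

Definition quot_eval (q : quotient_category) : D := F (repr (q : quot)).

Lemma quot_evalE a : quot_eval (quot_class a) = F a.
Proof. exact: fmap_cong (cong_repr a). Qed.

Fact quot_eval_dom (q : quotient_category) : quot_eval (dom q) = dom (quot_eval q).
Proof.
by elim/quot_ind: q => a; rewrite /= quot_domE !quot_evalE fmap_dom.
Qed.

Fact quot_eval_cod (q : quotient_category) : quot_eval (cod q) = cod (quot_eval q).
Proof.
by elim/quot_ind: q => a; rewrite /= quot_codE !quot_evalE fmap_cod.
Qed.

Fact quot_eval_mul (p q : quotient_category) : cod p = dom q ->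
  quot_eval (mul p q) = mul (quot_eval p) (quot_eval q).
Proof.
elim/quot_ind: p => a; elim/quot_ind: q => b /quot_composable ab.
by rewrite /= quot_mulE // !quot_evalE fmap_mul.
Qed.

Definition quot_lift : functor quotient_category D :=
  @Functor quotient_category D quot_eval
    quot_eval_dom quot_eval_cod quot_eval_mul.

End Lift.

End QuotientCategory.

Section UniversalGroupoid.
Variable C : category.

Definition object := {e : C | dom e == e}.

Fact dom_object (a : C) : dom (dom a) == dom a.
Proof. by rewrite dom_dom. Qed.

Fact cod_object (a : C) : dom (cod a) == cod a.
Proof. by rewrite dom_cod. Qed.

Definition odom (a : C) : object := exist _ (dom a) (dom_object a).
Definition ocod (a : C) : object := exist _ (cod a) (cod_object a).

(* The graph of C with a reversed edge adjoined for each arrow: inl a stands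
   for a, and inr a for the formal inverse of a. *)
Definition double_graph : graph :=
  @Graph object (C + C)%type
    (fun e => match e with inl a => odom a | inr a => ocod a end)
    (fun e => match e with inl a => ocod a | inr a => odom a end).

Definition Cpath := free_category double_graph.

Definition fwd (a : C) : Cpath := @gedge double_graph (inl a).
Definition bwd (a : C) : Cpath := @gedge double_graph (inr a).
Definition vpath (x : object) : Cpath := @gempty double_graph x.

Inductive groupoid_rel : Cpath -> Cpath -> Prop :=
| rel_inv_r a : groupoid_rel (mul (fwd a) (bwd a)) (vpath (odom a))
| rel_inv_l a : groupoid_rel (mul (bwd a) (fwd a)) (vpath (ocod a))
| rel_mul a b : cod a = dom b ->
    groupoid_rel (mul (fwd a) (fwd b)) (fwd (mul a b)).

Lemma object_eq (x y : object) : val x = val y -> x = y.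
Proof. exact: val_inj. Qed.

Fact groupoid_rel_parallel p q : groupoid_rel p q ->
  dom p = dom q /\ cod p = cod q.
Proof.
case=> [a|a|a b ab].
- by rewrite dom_mul // cod_mul.
- by rewrite dom_mul // cod_mul.
- have cab : cod (fwd a) = dom (fwd b).
    by congr (vpath _); apply: object_eq.
  rewrite dom_mul // cod_mul //.
  by split; congr (vpath _); apply: object_eq; rewrite /= ?dom_mul ?cod_mul.
Qed.

Definition universal_groupoid : category :=
  quotient_category groupoid_rel_parallel.

Definition path_class : functor Cpath universal_groupoid :=
  quotient_functor groupoid_rel_parallel.

Lemma path_classP (p q : Cpath) :
  path_class p = path_class q <-> cong groupoid_rel p q.
Proof. exact: quot_classP. Qed.

Lemma fwd_composable a b : cod a = dom b -> cod (fwd a) = dom (fwd b).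
Proof. by move=> ab; congr (vpath _); apply: object_eq. Qed.

(* An edge labelled by an identity is identified with the empty path. *)
Lemma cong_fwd_id (x : object) : cong groupoid_rel (fwd (val x)) (vpath x).
Proof.
have de : dom (val x) = val x by apply/eqP; exact: valP x.
have ce : cod (val x) = val x by rewrite -de cod_dom.
have ox : odom (val x) = x by apply: object_eq.
have oc : ocod (val x) = x by apply: object_eq.
set e := fwd _; set e' := bwd (val x).
have ee : cod e = dom e by apply: fwd_composable; rewrite de ce.
have e1 : cong groupoid_rel (mul e e') (vpath x).
  by rewrite -[X in vpath X]ox; apply: cong_gen; constructor.
have e2 : cong groupoid_rel (mul e e) e.
  have := @rel_mul (val x) (val x); rewrite ce de => /(_ erefl) /cong_gen.
  by rewrite -{3}de mul_dom.
have ex : cod e = dom (vpath x) by congr (vpath _).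
have e3 : cod e = dom (mul e e') by rewrite dom_mul.
apply: cong_trans (_ : cong _ (mul e (vpath x)) _).
  by rewrite -[vpath x]/(dom (vpath x)) -ex mul_cod; apply: cong_refl.
apply: cong_trans (_ : cong _ (mul e (mul e e')) _).
  by apply: cong_mul => //; [apply: cong_refl|apply: cong_sym].
rewrite mulA //; apply: cong_trans e1.
by apply: cong_mul => //; [rewrite cod_mul|apply: cong_refl].
Qed.

Fact canonical_dom (a : C) :
  path_class (fwd (dom a)) = dom (path_class (fwd a)).
Proof. by rewrite -fmap_dom; apply/path_classP; apply: (cong_fwd_id (odom a)). Qed.

Fact canonical_cod (a : C) :
  path_class (fwd (cod a)) = cod (path_class (fwd a)).
Proof. by rewrite -fmap_cod; apply/path_classP; apply: (cong_fwd_id (ocod a)). Qed.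

Fact canonical_mul (a b : C) : cod a = dom b ->
  path_class (fwd (mul a b)) = mul (path_class (fwd a)) (path_class (fwd b)).
Proof.
move=> ab; rewrite -fmap_mul; last exact: fwd_composable.
by apply/path_classP; apply/cong_sym/cong_gen; constructor.
Qed.

Definition canonical_functor : functor C universal_groupoid :=
  @Functor C universal_groupoid (fun a => path_class (fwd a))
    canonical_dom canonical_cod canonical_mul.

Lemma inverse_path_class (a : C) :
  inverse_of (path_class (fwd a)) (path_class (bwd a)).
Proof.
have ab : cod (fwd a) = dom (bwd a) by [].
have ba : cod (bwd a) = dom (fwd a) by [].
split; rewrite -?fmap_mul // -?fmap_dom -?fmap_cod ?ab ?ba //;
  apply/path_classP; apply: cong_gen; constructor.
Qed.

Lemma universal_groupoidP : groupoid universal_groupoid.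
Proof.
elim/quot_ind=> p; elim/gpath_ind: p => [x|e q eq IH].
  have -> : quot_class groupoid_rel (vpath x) =
      dom (path_class (vpath x)) by rewrite -fmap_dom.
  exact: invertible_dom.
have eq' : cod (@gedge double_graph e : Cpath) = dom (q : Cpath).
  by congr vpath.
rewrite -[quot_class _ _]/(path_class (mul (gedge e : Cpath) q)) fmap_mul //.
apply: invertible_mul => //; first by rewrite -fmap_cod -fmap_dom eq'.
case: e {eq eq'} => a.
  by exists (path_class (bwd a)); apply: inverse_path_class.
exists (path_class (fwd a)); have [? ? ea eb] := inverse_path_class a.
by split; rewrite ?ea ?eb.
Qed.

Theorem canonical_functor_universal (G : category) (F : functor C G) :
  groupoid G ->
  exists H : functor universal_groupoid G,
    (forall a, H (canonical_functor a) = F a) /\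
    forall H' : functor universal_groupoid G,
      (forall a, H' (canonical_functor a) = F a) -> forall u, H' u = H u.
Proof.
move=> hG; pose inv a := projT1 (cid (hG a)).
have invP a : inverse_of a (inv a) by rewrite /inv; case: cid.
pose fV (x : object) : G := F (val x).
pose fE (e : edge double_graph) : G :=
  match e with inl a => F a | inr a => inv (F a) end.
have dfV x : dom (fV x) = fV x by rewrite -fmap_dom (eqP (valP x)).
have dfE e : dom (fE e) = fV (src e).
  case: e => a; rewrite /fV /= ?fmap_dom ?fmap_cod //.
  by have [-> ] := invP (F a).
have cfE e : cod (fE e) = fV (tgt e).
  case: e => a; rewrite /fV /= ?fmap_dom ?fmap_cod //.
  by have [_ ->] := invP (F a).
pose L := @free_lift double_graph G fV fE dfV dfE cfE.
have Lf a : L (fwd a) = F a by rewrite /L /= /free_eval /= /fV /= fmap_cod mul_cod.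
have Lb a : L (bwd a) = inv (F a).
  rewrite /L /= /free_eval /= /fV /= fmap_dom.
  by have [_ <-] := invP (F a); rewrite mul_cod.
have LR p q : groupoid_rel p q -> L p = L q.
  case=> [a|a|a b ab].
  - rewrite fmap_mul // Lf Lb; have [_ _ -> _] := invP (F a).
    by rewrite -fmap_dom.
  - rewrite fmap_mul // Lf Lb; have [_ _ _ ->] := invP (F a).
    by rewrite -fmap_cod.
  - by rewrite fmap_mul ?(fwd_composable ab) // !Lf -fmap_mul.
exists (quot_lift groupoid_rel_parallel LR); split.
  by move=> a; rewrite -Lf; exact: (quot_evalE groupoid_rel_parallel LR).
move=> H' H'F; elim/quot_ind=> p.
transitivity (L p); last by apply/esym; exact: (quot_evalE groupoid_rel_parallel LR).
change (H' (path_class p) = L p).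
elim/gpath_ind: p => [x|e q eq IH].
  transitivity (F (val x)); last by [].
  rewrite -H'F; congr (H' _); apply/esym/path_classP; exact: cong_fwd_id.
have eq' : cod (@gedge double_graph e : Cpath) = dom (q : Cpath).
  by congr vpath.
have eq2 : cod (path_class (gedge e)) = dom (path_class q).
  by rewrite -fmap_cod -fmap_dom eq'.
rewrite -[gcat _ _]/(mul (gedge e : Cpath) q) !fmap_mul // IH; congr mul.
case: e {eq eq' eq2} => a.
  by rewrite -[RHS]/(L (fwd a)) Lf -H'F.
rewrite -[RHS]/(L (bwd a)) Lb; apply: inverse_of_uniq (invP _).
rewrite -H'F; apply: fmap_inverse; exact: inverse_path_class.
Qed.

End UniversalGroupoid.

(* Main.v *)
(* C is represented by permutations of a set containing a copy of C on which it
   acts by left multiplication.  In a Rees category every non-invertible arrow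
   is a product of atoms, unique up to inserting units, so such an action
   amounts to an action of the units together with one permutation F_x for each
   atom x representing a double coset of the units, subject only to
   F_x k = h F_x whenever h x = x k.  Two-sided cancellation makes the pairs
   (h, k) a group acting freely on both sides, and an equivariant
   Cantor-Bernstein argument extends left multiplication by x to such an F_x
   once the set has enough spare free orbits.  The resulting functor from C to a
   group factors through U(C) and separates parallel arrows. *)

From mathcomp Require Import all_boot finmap.
From mathcomp Require Import boolp classical_sets functions cardinality.
Require Import Defs.

Set Implicit Arguments.
Unset Strict Implicit.
Unset Printing Implicit Defensive.

Local Open Scope classical_set_scope.

(** * Cantor-Bernstein bijections commuting with symmetries *)

Section EquivariantBernstein.
Variables (A B : Type) (f : A -> B) (g : B -> A).
Hypotheses (f_inj : injective f) (g_inj : injective g).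

(** Points whose backward chain through [g] and [f] stops in [A], outside the image of [g]. There
    the bijection will be [f]; elsewhere it inverts [g]. *)
Inductive bernstein_side : A -> Prop :=
| side_base a : (forall b, g b <> a) -> bernstein_side a
| side_step a : bernstein_side a -> bernstein_side (g (f a)).

Lemma bernstein_side_equivariant (p p' : A -> A) (q q' : B -> B) :
  cancel p p' -> cancel q' q -> (forall a, f (p a) = q (f a)) ->
  (forall b, g (q b) = p (g b)) ->
  forall a, bernstein_side a -> bernstein_side (p a).
Proof.
move=> pK qK fp gq a; elim=> {a} [a ga|a _ IH].
  by apply: side_base => b gb; apply: (ga (q' b)); rewrite -[LHS]pK -gq qK gb.
by rewrite -gq -fp; apply: side_step.
Qed.

(** The decomposition is canonical, so every symmetry of [f] and [g] preserves it, and a single [F]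
    serves all symmetries. *)
Lemma equivariant_bernstein : exists F : A -> B, [/\ bijective F,
  forall a, (forall b, g b <> a) -> F a = f a &
  forall (p p' : A -> A) (q q' : B -> B),
    cancel p p' -> cancel p' p -> cancel q q' -> cancel q' q ->
    (forall a, f (p a) = q (f a)) -> (forall b, g (q b) = p (g b)) ->
    forall a, F (p a) = q (F a)].
Proof.
pose R a b := bernstein_side a /\ b = f a \/ ~ bernstein_side a /\ g b = a.
have Rfun a b b' : R a b -> R a b' -> b = b'.
  move=> [[sa ->]|[sa ga]] [[sa' ->]|[sa' ga']] //.
  by apply: g_inj; rewrite ga.
have Rinj a a' b : R a b -> R a' b -> a = a'.
  move=> [[sa ->]|[sa ga]] [[sa' e]|[sa' e]].
  - exact: f_inj.
  - by case: sa'; rewrite -e; apply: side_step.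
  - by case: sa; rewrite -ga e; apply: side_step.
  - by rewrite -ga -e.
have Rtot a : exists b, R a b.
  have [sa|sa] := EM (bernstein_side a); first by exists (f a); left.
  have [b gb] : exists b, g b = a.
    by apply: contrapT => /forallNP na; case: sa; apply: side_base.
  by exists b; right.
have Rsurj b : exists a, R a b.
  have [sb|sb] := EM (bernstein_side (g b)); last by exists (g b); right.
  suff [a sa fa] : exists2 a, bernstein_side a & f a = b by exists a; left.
  case E: _ / sb => [a na|a sa]; first by case: (na b).
  by exists a => //; apply: g_inj.
have [F FR] := choice Rtot; have [G GR] := choice Rsurj.
exists F; split.
- exists G => [a|b]; first exact: (Rinj _ _ _ (GR (F a)) (FR a)).
  exact: (Rfun _ _ _ (FR (G b)) (GR b)).
- move=> a na; case: (FR a) => [[//]|[sa _]].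
  by case: sa; apply: side_base.
- move=> p p' q q' pK p'K qK q'K fp gq a; apply: (Rfun (p a)) => //.
  case: (FR a) => [[sa ->]|[sa ga]].
    by left; split=> //; apply: (bernstein_side_equivariant pK q'K).
  right; split; last by rewrite gq ga.
  (* The inverse symmetry keeps points off the side from entering it. *)
  move=> spa; apply: sa; rewrite -[a]pK.
  apply: (bernstein_side_equivariant p'K qK) spa => [a'|b].
    by rewrite -{2}[a']p'K fp qK.
  by rewrite -{2}[b]q'K gq pK.
Qed.

End EquivariantBernstein.

(** * Pairs of free actions of one group *)

Lemma set_selector (T : Type) (t0 : T) :
  exists rho : set T -> T, forall P x, P x -> P (rho P).
Proof.
have [|rho rhoP] := @choice (set T) T (fun P y => P !=set0 -> P y).
  move=> P; have [[x Px]|P0] := EM (P !=set0); first by exists x.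
  by exists t0 => /P0.
by exists rho => P x Px; apply: rhoP; exists x.
Qed.

(* The families alpha and beta describe two free actions on T of one and the
   same group, indexed by I. *)
Record free_actions (T I : Type) (alpha beta : I -> T -> T) : Prop := {
  fa_one : exists i, (forall t, alpha i t = t) /\ (forall t, beta i t = t);
  fa_mul : forall i j, exists k, (forall t, alpha k t = alpha i (alpha j t)) /\
    (forall t, beta k t = beta i (beta j t));
  fa_inv : forall i, exists k, [/\ cancel (alpha i) (alpha k),
    cancel (alpha k) (alpha i), cancel (beta i) (beta k) &
    cancel (beta k) (beta i)];
  fa_free : forall i j t t', alpha i t = alpha j t <-> beta i t' = beta j t'
}.

Lemma free_actions_sym (T I : Type) (alpha beta : I -> T -> T) :
  free_actions alpha beta -> free_actions beta alpha.
Proof.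
move=> [[i [a1 b1]] fm fi ff]; split.
- by exists i.
- by move=> i1 j; have [k []] := fm i1 j; exists k.
- by move=> i1; have [k []] := fi i1; exists k.
- by move=> i1 j t t'; have := ff i1 j t' t; tauto.
Qed.

(* Any two free orbits are isomorphic; the second component records which orbit
   the point came from. *)
Lemma free_actions_embed (T I : Type) (t0 : T) (alpha beta : I -> T -> T) :
  free_actions alpha beta ->
  exists u : T -> T * T, injective u /\
    forall i t, u (alpha i t) = (beta i (u t).1, (u t).2).
Proof.
move=> [[e [a1 b1]] fm fi ff]; have [rho rhoP] := set_selector t0.
pose O t : set T := [set r | exists i, alpha i r = t].
have Orefl t : O t t by exists e.
have Oact i t : O (alpha i t) = O t.
  have [k [ik ki _ _]] := fi i.
  apply/seteqP; split=> r [j jr].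
    by have [l [lE _]] := fm k j; exists l; rewrite lE jr ik.
  by have [l [lE _]] := fm i j; exists l; rewrite lE jr.
(* [c t] carries the base point [rho (O t)], which depends only on the orbit, to [t]. By freeness,
   sending [t] to [beta (c t) t0] identifies its orbit with that of [t0]. *)
have [c cP] := choice (fun t => rhoP (O t) t (Orefl t)).
exists (fun t => (beta (c t) t0, rho (O t))); split=> [t t' [bt rt]|i t].
  by rewrite -[t]cP -[t']cP -rt; apply/(ff _ _ _ t0).
rewrite Oact /=; congr pair; have [k [kE kE']] := fm i (c t).
rewrite -kE'; apply/(ff _ _ (rho (O t))).
by rewrite kE cP -(Oact i t) cP.
Qed.

(* The second factor provides as many spare orbits as there are points, so that
   the complements of D and of its image become isomorphic. *)
Lemma equivariant_extension (T I : Type) (t0 : T) (alpha beta : I -> T -> T)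
    (D : set T) (h : T -> T) :
  free_actions alpha beta ->
  (forall t t', D t -> D t' -> h t = h t' -> t = t') ->
  (forall i t, D t -> D (alpha i t)) ->
  (forall i t, D t -> h (alpha i t) = beta i (h t)) ->
  exists F : T * seq T -> T * seq T, [/\ bijective F,
    forall t, D t -> F (t, [::]) = (h t, [::]) &
    forall i s, F (alpha i s.1, s.2) = (beta i (F s).1, (F s).2)].
Proof.
move=> act h_inj D_act h_act.
have [u [u_inj u_act]] := free_actions_embed t0 act.
have [v [v_inj v_act]] := free_actions_embed t0 (free_actions_sym act).
(* Only points over [D] receive an empty list, and the recorded orbit label keeps [f] injective
   elsewhere. *)
pose f (s : T * seq T) := if `[< s.2 = [::] /\ D s.1 >] then (h s.1, [::])
  else ((u s.1).1, (u s.1).2 :: s.2).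
(* No value of [g] has an empty list, so [F] agrees with [f] on every [(t, [::])]. *)
pose g (s : T * seq T) := ((v s.1).1, (v s.1).2 :: s.2).
have f_inj : injective f.
  move=> [t l] [t' l']; rewrite /f /=.
  case: asboolP => [[-> Dt]|_]; case: asboolP => [[-> Dt']|_] //.
    by case=> /h_inj ->.
  by case=> e1 e2 ->; congr pair; apply: u_inj; rewrite [LHS]surjective_pairing
    [RHS]surjective_pairing e1 e2.
have g_inj : injective g.
  move=> [t l] [t' l'] [/= e1 e2 ->]; congr pair; apply: v_inj.
  by rewrite [LHS]surjective_pairing [RHS]surjective_pairing e1 e2.
have [F [F_bij Ff F_act]] := equivariant_bernstein f_inj g_inj.
have D_actE i t : D (alpha i t) = D t.
  apply/propext; split=> [|/D_act//]; have [k [ik _ _ _]] := fa_inv act i.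
  by move=> /(D_act k); rewrite ik.
exists F; split=> // [t Dt|i s].
  rewrite Ff => [|b]; last by [].
  by rewrite /f asboolT.
have [k [ik ki ik' ki']] := fa_inv act i.
apply: (F_act (fun s => (alpha i s.1, s.2)) (fun s => (alpha k s.1, s.2))
  (fun s => (beta i s.1, s.2)) (fun s => (beta k s.1, s.2))).
- by move=> [t l]; rewrite /= ik.
- by move=> [t l]; rewrite /= ki.
- by move=> [t l]; rewrite /= ik'.
- by move=> [t l]; rewrite /= ki'.
- move=> [t l]; rewrite /f /= D_actE u_act.
  by case: asboolP => [[_ Dt]|//]; rewrite h_act.
- by move=> [t l]; rewrite /g /= v_act.
Qed.

(** * Units, atoms and principal right ideals under left cancellation *)

Lemma inverse_invertible (C : category) (a b : C) :
  inverse_of a b -> invertible b.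
Proof. by move=> [ab ba e e']; exists a; split; rewrite ?e ?e'. Qed.

Section CancellativeCategory.
Variable C : category.
Hypothesis C_lcan : left_cancellative C.
Implicit Types a b c u v x y : C.

(** Cancel [a] in [a (c a) = (a c) a = a]. *)
Lemma right_invertible a c : cod a = dom c -> mul a c = dom a -> invertible a.
Proof.
move=> ac e; exists c.
have ca : cod c = dom a by rewrite -(cod_mul ac) e cod_dom.
split=> //; apply: (C_lcan (a := a)); rewrite ?dom_mul ?dom_cod //.
by rewrite mulA // e mul_dom mul_cod.
Qed.

Lemma invertible_factors a b : cod a = dom b -> invertible (mul a b) ->
  invertible a /\ invertible b.
Proof.
move=> ab iab; have [d [bd _ e _]] := iab.
rewrite cod_mul // in bd; rewrite dom_mul // in e.
have ia : invertible a.
  by apply: (@right_invertible _ (mul b d)); rewrite ?dom_mul ?mulA.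
split=> //; case: ia => a' [aa' a'a e1 e2].
have -> : b = mul a' (mul a b) by rewrite mulA // e2 ab mul_dom.
by apply: invertible_mul; rewrite ?dom_mul //; apply: (@inverse_invertible _ a).
Qed.

Definition atom y := ~ invertible y /\
  forall u v, cod u = dom v -> y = mul u v -> invertible u \/ invertible v.

(** A factorization [u v] of [x] gives the factorization [(g u) (v h)] of an atom, and factors of a
    unit are units. *)
Lemma atom_mul_unit g x h : cod g = dom x -> cod x = dom h ->
  invertible g -> invertible h -> atom (mul (mul g x) h) -> atom x.
Proof.
move=> gx xh ig ih [ny yuv]; split=> [ix|u v uv xE].
  by apply: ny; do 2 ?apply: invertible_mul; rewrite ?cod_mul.
have gu : cod g = dom u by rewrite gx xE dom_mul.
have vh : cod v = dom h by rewrite -xh xE cod_mul.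
have [||/(invertible_factors gu)[]|/(invertible_factors vh)[]] :=
  yuv (mul g u) (mul v h); try by [left|right].
  by rewrite cod_mul // dom_mul.
by rewrite xE (mulA gu uv) mulA ?cod_mul.
Qed.

Lemma mem_pr_ideal a : pr_ideal a a.
Proof. by exists (cod a); rewrite ?dom_cod ?mul_cod. Qed.

Lemma pr_ideal_sub a b : pr_ideal b a -> pr_ideal a `<=` pr_ideal b.
Proof.
move=> [c bc ->] x [d]; rewrite cod_mul // => cd ->.
by exists (mul c d); rewrite ?dom_mul ?mulA.
Qed.

Lemma pr_ideal_dom a b : pr_ideal b a -> dom a = dom b.
Proof. by move=> [c bc ->]; rewrite dom_mul. Qed.

End CancellativeCategory.

(** * Heights and factorization into atoms *)

Section LeftRees.
Variable C : category.
Hypothesis C_lrees : left_rees C.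
Implicit Types a b c u v x y : C.

Let C_lcan : left_cancellative C. Proof. by case: C_lrees. Qed.

Definition above a : set (set C) :=
  [set I | range (@pr_ideal C) I /\ pr_ideal a `<` I].

(** A true count: the left Rees condition makes [above a] finite, whereas [fset_set] is empty on
    infinite sets. *)
Definition height a : nat := #|` fset_set (above a)|%fset.

Lemma height_lt a b : pr_ideal a `<` pr_ideal b -> (height b < height a)%N.
Proof.
move=> ab; have fin c : finite_set (above c) by case: C_lrees => _ _; apply.
apply/fproper_ltn_card; rewrite fproperE.
apply/andP; split; last apply/negP; rewrite -fset_set_sub //.
  move=> I [rI [bI Ib]]; split=> //; split=> [x /(properW ab)/bI//|Ia].
  by apply: Ib => x /Ia /(properW ab).
by move=> /(_ (pr_ideal b))[]; [split=> //; exists b|move=> _ []].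
Qed.

(** Among the [b] whose ideal properly contains that of [a], one of greatest height has no ideal
    strictly in between, so the quotient [y] is an atom. *)
Lemma atom_factorization a : ~ invertible a -> exists b y,
  [/\ cod b = dom y, a = mul b y, atom y & (height b < height a)%N].
Proof.
move=> na.
pose P n := `[< exists2 b, pr_ideal a `<` pr_ideal b & height b = n >].
have [n0 Pn0] : exists n, P n.
  (* If the ideals of [a] and [dom a] coincided, [a] would be right invertible. *)
  exists (height (dom a)); apply/asboolP; exists (dom a) => //; split.
    by apply: pr_ideal_sub; exists a; rewrite ?cod_dom ?mul_dom.
  move=> /(_ _ (mem_pr_ideal (dom a)))[c ac e]; apply: na.
  exact: (right_invertible C_lcan (c := c)).
have Pmax n : P n -> (n <= height a)%N.
  by move=> /asboolP[b /height_lt/ltnW ? <-].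
case: (ex_maxnP (ex_intro _ n0 Pn0) Pmax) => n /asboolP[b ab <-] bmax.
have [y byd aE] : pr_ideal b a by apply: (properW ab); apply: mem_pr_ideal.
exists b, y; split=> //; last exact: height_lt.
split=> [[y' [yy' y'y e _]]|u v uv yE].
  case: ab => _; apply; apply: pr_ideal_sub; exists y'.
    by rewrite aE cod_mul.
  by rewrite aE -mulA // e -byd mul_cod.
have bu : cod b = dom u by rewrite byd yE dom_mul.
have buv : cod (mul b u) = dom v by rewrite cod_mul.
have aE' : a = mul (mul b u) v by rewrite aE yE mulA.
have abu : pr_ideal a `<=` pr_ideal (mul b u).
  by apply: pr_ideal_sub; exists v.
(* The ideal of [b u] lies between those of [a] and [b]. Equality with the former makes [v]
   invertible; otherwise maximality forces equality with the latter, and [u] is invertible. *)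
have [nu|nu] := EM (pr_ideal (mul b u) `<=` pr_ideal a).
  right; have [w aw] := nu _ (mem_pr_ideal _).
  rewrite aE' cod_mul // in aw *; rewrite -mulA // => e.
  apply: (right_invertible C_lcan (c := w)) => //.
  apply: (C_lcan (a := mul b u)); rewrite ?dom_mul ?dom_dom //.
  by rewrite -e -buv mul_cod.
left; have : (height (mul b u) <= height b)%N.
  by apply: bmax; apply/asboolP; exists (mul b u).
rewrite leqNgt => /negP hb.
have [bbu|nbu] := EM (pr_ideal b `<=` pr_ideal (mul b u)); last first.
  case: hb; apply: height_lt; split=> //.
  by apply: pr_ideal_sub; exists u.
have [w] := bbu _ (mem_pr_ideal _); rewrite cod_mul // => uw.
rewrite -mulA // => e; apply: (right_invertible C_lcan (c := w)) => //.
apply: (C_lcan (a := b)); rewrite ?dom_mul ?dom_dom //.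
by rewrite -e -bu mul_cod.
Qed.

(** The ideals of [b] and [b'] meet in the common product, so rigidity makes them comparable. If
    [b = b' h], then [y' = h y] by cancellation, and [h] is a unit because [y'] is an atom and [y]
    is no unit. *)
Lemma atom_factorization_unique b b' y y' :
  cod b = dom y -> cod b' = dom y' -> atom y -> atom y' ->
  mul b y = mul b' y' ->
  exists h, [/\ invertible h, cod b' = dom h, cod h = dom y,
    b = mul b' h & y' = mul h y].
Proof.
move=> bz bz' ay ay' e; have [_ rigid _] := C_lrees.
have wl c c' z z' : cod c = dom z -> cod c' = dom z' -> atom z -> atom z' ->
    mul c z = mul c' z' -> pr_ideal c `<=` pr_ideal c' ->
    exists h, [/\ invertible h, cod c' = dom h, cod h = dom z,
      c = mul c' h & z' = mul h z].
  move=> cz cz' [nz _] [_ z'uv] eq /(_ _ (mem_pr_ideal c))[h c'h cE].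
  have hz : cod h = dom z by rewrite -cz cE cod_mul.
  have z'E : z' = mul h z.
    by apply: (C_lcan (a := c')); rewrite ?dom_mul // -eq cE mulA.
  by exists h; split=> //; case: (z'uv _ _ hz z'E).
have [|bb'|b'b] := rigid b b'; last 2 first.
- exact: wl.
- have [h [[h' [hh' h'h eh eh']] bh hy b'E yE]] :=
    wl _ _ _ _ bz' bz ay' ay (esym e) b'b.
  exists h'; split.
  + by apply: (@inverse_invertible _ h); split.
  + by rewrite b'E cod_mul.
  + by rewrite h'h -bh.
  + by rewrite b'E -mulA // eh -bh mul_cod.
  + by rewrite yE mulA // eh' hy mul_dom.
by exists (mul b y); split; [exists y|exists y'].
Qed.

End LeftRees.

(** * The set on which the units act *)

Section Sections.
Variable C : category.
Implicit Types a c g h k x : C.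

(* The product of the sets of arrows with domain a, over all arrows a: the
   invertible arrows g at an object e act on the component of e, and the actions
   at all objects live on the same set and are free. *)
Definition dom_section := {t : C -> C | forall a, dom (t a) = dom a}.
Implicit Types t : dom_section.

Lemma dom_section_eq t t' : sval t =1 sval t' -> t = t'.
Proof.
by case: t t' => [t ht] [t' ht'] /= /funext e; apply: eq_exist.
Qed.

Definition sec_id : dom_section := exist _ id (fun=> erefl).

Fact sec_single_subproof c a :
  dom (if a == dom c then c else a) = dom a.
Proof. by case: eqP => // ->; rewrite dom_dom. Qed.

Definition sec_single c : dom_section := exist _ _ (sec_single_subproof c).

(** Equality of domains matters: every identity is sent to the section [sec_id]. *)
Lemma sec_single_inj c c' :
  dom c = dom c' -> sec_single c = sec_single c' -> c = c'.
Proof.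
by move=> cc' /(congr1 (fun t => sval t (dom c))) /=; rewrite -cc' eqxx.
Qed.

(** The test [cod g == dom g] makes the action total; in a skeletal category all units pass it. *)
Fact sec_act_subproof g t a :
  dom (if (a == dom g) && (cod g == dom g) then mul g (sval t a) else sval t a)
    = dom a.
Proof.
case: ifP => [/andP[/eqP -> /eqP cg]|_]; last exact: (svalP t).
by rewrite dom_mul ?dom_dom // (svalP t) dom_dom.
Qed.

Definition sec_act g t : dom_section := exist _ _ (sec_act_subproof g t).

Lemma sec_actE g t a : cod g = dom g ->
  sval (sec_act g t) a = if a == dom g then mul g (sval t a) else sval t a.
Proof. by move=> cg; rewrite /= cg eqxx andbT. Qed.

Lemma sec_act_dom a t : sec_act (dom a) t = t.
Proof.
apply: dom_section_eq => b; rewrite sec_actE ?cod_dom ?dom_dom //.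
case: eqP => // ->; rewrite -{2}(mul_dom (sval t (dom a))).
by rewrite (svalP t) dom_dom.
Qed.

Lemma sec_act_mul g h t : cod g = dom g -> cod h = dom h -> dom g = dom h ->
  sec_act (mul g h) t = sec_act g (sec_act h t).
Proof.
move=> cg ch gh; have cgh : cod g = dom h by rewrite cg.
apply: dom_section_eq => a; rewrite !sec_actE ?cod_mul ?dom_mul ?ch // -gh.
by case: eqP => // ->; rewrite mulA // ch (svalP t) dom_dom.
Qed.

Lemma sec_act_single g c : cod g = dom g -> dom g = dom c ->
  sec_act g (sec_single c) = sec_single (mul g c).
Proof.
move=> cg gc; apply: dom_section_eq => a; rewrite sec_actE //= dom_mul ?cg //.
by rewrite gc; case: eqP.
Qed.

End Sections.

(** * Extending left multiplication by an arrow to a permutation *)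

Section Representation.
Variable C : category.
Hypotheses (C_rees : rees C) (C_skel : skeletal C).
Implicit Types a b c g h k x y : C.

Let C_lrees : left_rees C. Proof. by case: C_rees. Qed.
Let C_lcan : left_cancellative C. Proof. by case: C_lrees. Qed.
Let C_rcan : right_cancellative C. Proof. by case: C_rees. Qed.

Let point : Type := (dom_section C * seq (dom_section C))%type.

Definition point_of c : point := (sec_single c, [::]).
Definition unit_act g (s : point) : point := (sec_act g s.1, s.2).

(** At component [dom g] both sides multiply the same arrow, which right cancellation removes. *)
Lemma sec_act_free g h t : invertible g -> invertible h -> dom g = dom h ->
  sec_act g t = sec_act h t -> g = h.
Proof.
move=> /C_skel cg /C_skel ch gh e.
have := congr1 (fun t => sval t (dom g)) e.
rewrite !sec_actE // -gh eqxx; apply: C_rcan; rewrite (svalP t) dom_dom //.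
by rewrite -ch.
Qed.

Definition intertwiner x (p : C * C) : Prop :=
  [/\ invertible p.1, invertible p.2, cod p.1 = dom x, cod x = dom p.2 &
      mul p.1 x = mul x p.2].

(** In [h x = x k] each of [h] and [k] determines the other, by cancelling [x] on the appropriate
    side. *)
Lemma intertwiner_free x : free_actions
  (fun p : {p | intertwiner x p} => @sec_act C (sval p).2)
  (fun p : {p | intertwiner x p} => @sec_act C (sval p).1).
Proof.
split.
- have ip : intertwiner x (dom x, cod x).
    split; rewrite /= ?cod_dom ?dom_cod ?mul_dom ?mul_cod //.
      exact: invertible_dom.
    by rewrite -dom_cod; exact: invertible_dom.
  by exists (exist _ _ ip); split=> t /=; rewrite -1?dom_cod sec_act_dom.
- move=> [[h k] [/= ih ik hx xk e]] [[h' k'] [/= ih' ik' hx' xk' e']].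
  have [sh sk sh' sk'] :=
    And4 (C_skel ih) (C_skel ik) (C_skel ih') (C_skel ik').
  have hh' : cod h = dom h' by rewrite sh' hx' hx.
  have kk' : cod k = dom k' by rewrite -sk -xk xk'.
  have ip : intertwiner x (mul h h', mul k k').
    split; rewrite /= ?cod_mul ?dom_mul //; try exact: invertible_mul.
    by rewrite -mulA // e' mulA // e -mulA.
  by exists (exist _ _ ip); split=> t /=; apply: sec_act_mul => //;
    rewrite ?sh ?sk.
- move=> [[h k] [/= ih ik hx xk e]].
  have [sh sk] := (C_skel ih, C_skel ik).
  have [[h' [hh' h'h eh eh']] [k' [kk' k'k ek ek']]] := (ih, ik).
  have ih' : invertible h' by apply: (@inverse_invertible _ h); split.
  have ik' : invertible k' by apply: (@inverse_invertible _ k); split.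
  have [sh' sk'] := (C_skel ih', C_skel ik').
  have ip : intertwiner x (h', k').
    split; rewrite /= ?h'h ?sh ?xk ?sk //.
    have xkk : mul (mul x k) k' = x by rewrite -mulA // ek -xk mul_cod.
    have hxk : cod (mul h x) = dom k' by rewrite cod_mul // xk sk.
    by rewrite -{1}xkk -e !mulA ?dom_mul ?cod_mul ?eh' ?hx ?mul_dom // xk sk.
  have act_inv g g' : dom g = cod g -> dom g' = cod g' -> cod g = dom g' ->
      mul g g' = dom g -> cancel (@sec_act C g') (@sec_act C g).
    by move=> sg sg' gg' eg t; rewrite -sec_act_mul ?eg ?sec_act_dom ?sg.
  exists (exist _ _ ip); split; apply: act_inv => //=.
  + by rewrite ek' kk'.
  + by rewrite eh' hh'.
- move=> [[h k] [/= ih ik hx xk e]] [[h' k'] [/= ih' ik' hx' xk' e']] t t'.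
  have [sh sk sh' sk'] :=
    And4 (C_skel ih) (C_skel ik) (C_skel ih') (C_skel ik').
  split=> [/sec_act_free kk|/sec_act_free hh].
    have {}kk : k = k' by apply: kk; rewrite // -xk -xk'.
    suff -> : h = h' by [].
    by apply: (C_rcan (a := x)) => //; rewrite e e' kk.
  have {}hh : h = h' by apply: hh; rewrite // sh sh' hx hx'.
  suff -> : k = k' by [].
  by apply: (C_lcan (a := x)) => //; rewrite -e -e' hh.
Qed.

Lemma arrow_extension x : exists F : point -> point, [/\ bijective F,
  forall c, cod x = dom c -> F (point_of c) = point_of (mul x c) &
  forall h k s, intertwiner x (h, k) ->
    F (unit_act k s) = unit_act h (F s)].
Proof.
pose D : set (dom_section C) :=
  [set t | exists2 c, cod x = dom c & t = sec_single c].
(* Component [cod x] of [sec_single c] is [c] itself when [c] is in [D]'s range of arrows; off [D]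
   the value is irrelevant. *)
pose at_x (t : dom_section C) : dom_section C :=
  sec_single (mul x (sval t (cod x))).
have at_xE c : cod x = dom c -> at_x (sec_single c) = sec_single (mul x c).
  by move=> xc; rewrite /at_x /= xc eqxx.
have [|||F [F_bij FD F_act]] := @equivariant_extension _ _ (sec_id C) _ _ D at_x
  (intertwiner_free x).
- move=> t t' [c xc ->] [c' xc' ->]; rewrite !at_xE // => /sec_single_inj.
  by rewrite !dom_mul // => /(_ erefl)/C_lcan->.
- move=> [[h k] [/= _ /C_skel sk _ xk _]] t [c xc ->].
  exists (mul k c); first by rewrite dom_mul // -sk -xk.
  by rewrite sec_act_single // -xk.
- move=> [[h k] [/= /C_skel sh /C_skel sk hx xk e]] t [c xc ->] /=.
  rewrite sec_act_single //; last by rewrite -xk.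
  have kc : cod k = dom c by rewrite -sk -xk.
  rewrite !at_xE ?dom_mul // -?xk //.
  by rewrite sec_act_single ?dom_mul ?sh // !mulA // e.
exists F; split=> // [c xc|h k s ip].
  by rewrite FD ?at_xE //; exists c.
by have := F_act (exist _ _ ip) s.
Qed.

(** * Double cosets of the units *)

Definition double_coset x : set C := [set y | exists g h,
  [/\ invertible g, invertible h, cod g = dom x, cod x = dom h &
      y = mul (mul g x) h]].

Lemma double_coset_refl x : double_coset x x.
Proof.
exists (dom x), (cod x); rewrite cod_dom dom_cod mul_dom mul_cod; split=> //.
  exact: invertible_dom.
by rewrite -dom_cod; exact: invertible_dom.
Qed.

Lemma double_coset_sym x y : double_coset x y -> double_coset y x.
Proof.
move=> [g [h [ig ih gx xh ->]]].
have [[g' [gg' g'g eg eg']] [h' [hh' h'h eh eh']]] := (ig, ih).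
have ghE : cod (mul g x) = dom h by rewrite cod_mul.
exists g', h'; rewrite cod_mul // !dom_mul //; split=> //.
- by apply: (@inverse_invertible _ g); split.
- by apply: (@inverse_invertible _ h); split.
rewrite !mulA ?dom_mul // eg' gx mul_dom -mulA // eh -xh mul_cod //.
Qed.

Lemma double_coset_trans x y z :
  double_coset x y -> double_coset y z -> double_coset x z.
Proof.
move=> [g [h [ig ih gx xh ->]]] [g' [h' [ig' ih' g'g hh' ->]]].
have gxh : cod (mul g x) = dom h by rewrite cod_mul.
rewrite !dom_mul // in g'g; rewrite cod_mul // in hh'.
exists (mul g' g), (mul h h'); rewrite cod_mul // dom_mul //.
split=> //; try exact: invertible_mul.
by rewrite !mulA ?dom_mul ?cod_mul.
Qed.

Lemma double_coset_eq x y : double_coset x y -> double_coset x = double_coset y.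
Proof.
move=> xy; apply/seteqP; split=> z; apply: double_coset_trans => //.
exact: double_coset_sym.
Qed.

Lemma unit_act_dom a : unit_act (dom a) = id.
Proof. by apply/funext => -[t l]; rewrite /unit_act /= sec_act_dom. Qed.

Lemma unit_act_mul g h : invertible g -> invertible h -> cod g = dom h ->
  unit_act (mul g h) = unit_act g \o unit_act h.
Proof.
move=> /C_skel sg /C_skel sh gh; apply/funext => -[t l].
by rewrite /unit_act /= sec_act_mul // sg.
Qed.

Lemma unit_act_bij g : invertible g -> bijective (unit_act g).
Proof.
move=> ig; have [h [gh hg e e']] := ig.
have ih : invertible h by apply: (@inverse_invertible _ g).
exists (unit_act h) => s.
  by rewrite -[LHS]/((_ \o _) s) -unit_act_mul // e' -dom_cod unit_act_dom.
by rewrite -[LHS]/((_ \o _) s) -unit_act_mul // e unit_act_dom.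
Qed.

(** * Permutations attached to factorizations into atoms *)

Variables (Psi : C -> point -> point) (rep : C -> C).
Hypothesis Psi_bij : forall x, bijective (Psi x).
Hypothesis Psi_point : forall x c, cod x = dom c ->
  Psi x (point_of c) = point_of (mul x c).
Hypothesis Psi_act : forall x h k s, intertwiner x (h, k) ->
  Psi x (unit_act k s) = unit_act h (Psi x s).
Hypothesis repP : forall x, double_coset x (rep x).
Hypothesis rep_eq : forall x y, double_coset x y -> rep x = rep y.

(** A relation, since factorizations are unique only up to units. Words alternate units with atoms,
    and the atoms are chosen representatives. *)
Inductive acts : C -> (point -> point) -> Prop :=
| acts_unit g : invertible g -> acts g (unit_act g)
| acts_snoc b f x g : acts b f -> cod b = dom x -> cod x = dom g -> atom x ->
    rep x = x -> invertible g ->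
    acts (mul b (mul x g)) (f \o Psi x \o unit_act g).

Lemma acts_inv a f : acts a f ->
  (invertible a /\ f = unit_act a) \/
  exists b f' x g, [/\ acts b f', cod b = dom x & cod x = dom g] /\
    [/\ atom x, rep x = x, invertible g, a = mul b (mul x g) &
        f = f' \o Psi x \o unit_act g].
Proof.
by case=> [g ig|b f' x g *]; [left | right; exists b, f', x, g].
Qed.

Lemma acts_mul_unit a f g : acts a f -> cod a = dom g -> invertible g ->
  acts (mul a g) (f \o unit_act g).
Proof.
case=> [h ih|b f' x h bf bx xh ax rx ih] ag ig.
  by rewrite -unit_act_mul //; apply: acts_unit; apply: invertible_mul.
rewrite !cod_mul ?dom_mul // in ag.
rewrite -!mulA ?cod_mul ?dom_mul // -compA -unit_act_mul //.
by apply: acts_snoc; rewrite ?dom_mul //; apply: invertible_mul.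
Qed.

Lemma acts_mul a f b f' : acts a f -> acts b f' -> cod a = dom b ->
  acts (mul a b) (f \o f').
Proof.
move=> af; elim=> {b f'} [g ig|b f' x g bf IH bx xg ax rx ig] ab.
  exact: acts_mul_unit.
rewrite dom_mul ?dom_mul // in ab.
rewrite mulA ?dom_mul //; rewrite -[_ \o _]/((f \o f') \o Psi x \o unit_act g).
by apply: acts_snoc; rewrite ?cod_mul //; apply: IH.
Qed.

Lemma atom_unit x g : cod x = dom g -> invertible g -> atom x -> atom (mul x g).
Proof.
move=> xg [h [gh hg e e']] ax.
apply: (@atom_mul_unit _ C_lcan (dom x) (mul x g) h).
- by rewrite cod_dom dom_mul.
- by rewrite cod_mul.
- exact: invertible_dom.
- by apply: (@inverse_invertible _ g); split.
by rewrite -{1}(dom_mul xg) mul_dom -mulA // e -xg mul_cod.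
Qed.

(** The last atoms of two words differ by units, so they have the same representative and are equal.
    The unit [h] left over is moved across [Psi x], and induction treats the prefix. *)
Lemma acts_functional a f f' : acts a f -> acts a f' -> f = f'.
Proof.
have nunit b x g : cod b = dom x -> cod x = dom g -> atom x ->
    ~ invertible (mul b (mul x g)).
  move=> bx xg [nx _]; have bxg : cod b = dom (mul x g) by rewrite dom_mul.
  move=> /(invertible_factors C_lcan bxg)[_].
  by move=> /(invertible_factors C_lcan xg)[].
move=> af; elim: af f' => {a f} [g ig|b f x g bf IH bx xg ax rx ig] f'.
  move=> /acts_inv; case=> [[]//|[b [f1 [x [h [[_ bx xh] [ax _ _ gE _]]]]]]].
  by case: (nunit b x h); rewrite -?gE.
move=> /acts_inv; case=> [[/nunit[]//]|].
move=> [b' [f1 [x' [g' [[bf1 bx' xg'] [ax' rx' ig' e ->]]]]]].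
have := atom_factorization_unique C_lrees _ _ _ _ e; rewrite !dom_mul //.
case=> //; try exact: atom_unit; move=> h [ih b'h hx bE xgE].
have [k [g'k kg' ek ek']] := ig'.
have ik : invertible k by apply: (@inverse_invertible _ g'); split.
have gg' : cod g = cod g'.
  by rewrite -(cod_mul xg') xgE !cod_mul ?dom_mul.
have xx : x = x'.
  have gk : cod g = dom k by rewrite gg'.
  rewrite -rx -rx'; apply: rep_eq; exists h, (mul g k).
  split; rewrite ?dom_mul //; first exact: invertible_mul.
  rewrite -[LHS]mul_cod xg' -ek mulA // xgE -!mulA ?dom_mul ?cod_mul //.
subst x'; have -> : f = f1 \o unit_act h.
  by apply: IH; rewrite bE; apply: acts_mul_unit.
have [l [gl lg el el']] := ig; have il : invertible l.
  by apply: (@inverse_invertible _ g); split.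
have g'l : cod g' = dom l by rewrite -gg'.
(* With [l] inverse to [g], the equation [x g' = h (x g)] becomes [h x = x (g' l)]. *)
have hk : intertwiner x (h, mul g' l).
  split; rewrite /= ?dom_mul //; first exact: invertible_mul.
  by rewrite mulA // xgE -!mulA ?dom_mul ?cod_mul // el -xg mul_cod.
apply/funext => s /=; rewrite -(Psi_act _ hk).
rewrite -[unit_act _ (unit_act g s)]/((_ \o _) s).
rewrite -unit_act_mul ?cod_mul //; last exact: invertible_mul.
by rewrite -mulA // el' gg' mul_cod.
Qed.

(** Induction on height: split off a last atom [g r h] with [r] its representative, and absorb [g]
    into the prefix. *)
Lemma acts_total a : exists f, acts a f.
Proof.
have [n] := ubnP (height a); elim: n a => // n IH a; rewrite ltnS => an.
have [ia|na] := EM (invertible a).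
  by exists (unit_act a); apply: acts_unit.
have [b [y [byd aE ay ba]]] := atom_factorization C_lrees na.
have [f bf] := IH b (leq_trans ba an).
have [g [h [ig ih gx xh yE]]] := double_coset_sym (repP y).
have rr : rep (rep y) = rep y by apply/esym/rep_eq/repP.
move: (rep y) => r in gx xh yE rr; rewrite {}yE in byd aE ay.
have grh : cod (mul g r) = dom h by rewrite cod_mul.
have bg : cod b = dom g by rewrite byd !dom_mul.
exists (f \o unit_act g \o Psi r \o unit_act h).
have -> : a = mul (mul b g) (mul r h).
  by rewrite aE !mulA ?dom_mul ?cod_mul.
apply: acts_snoc; rewrite ?cod_mul //; first exact: acts_mul_unit.
exact: (atom_mul_unit C_lcan gx xh ig ih).
Qed.

(** Taking [c = cod a] recovers [point_of a] from the permutation. *)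
Lemma acts_point a f c : acts a f -> cod a = dom c ->
  f (point_of c) = point_of (mul a c).
Proof.
move=> af; elim: af c => {a f} [g /C_skel sg|b f x g bf IH bx xg ax rx ig] c ac.
  by rewrite /unit_act /= sec_act_single ?sg.
rewrite !cod_mul ?dom_mul // in ac; have sg := C_skel ig.
rewrite /= /unit_act /= sec_act_single ?sg // -/(point_of _).
by rewrite Psi_point ?IH ?dom_mul // !mulA ?dom_mul ?cod_mul.
Qed.

Lemma acts_bij a f : acts a f -> bijective f.
Proof.
elim=> {a f} [g|b f x g _ fb _ _ _ _ ig]; first exact: unit_act_bij.
by do 2 ?apply: bij_comp => //; apply: unit_act_bij.
Qed.

End Representation.

(** * Permutation groups as one-object categories *)

Section PermutationCategory.
Variable S : Type.

Definition perm := {f : S -> S | bijective f}.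

Lemma perm_eq (p q : perm) : sval p = sval q -> p = q.
Proof. by case: p q => [f hf] [g hg] /= e; apply: eq_exist. Qed.

Definition perm_id : perm := exist _ id (Bijective (frefl id) (frefl id)).
Definition perm_comp (p q : perm) : perm :=
  exist _ (sval p \o sval q) (bij_comp (svalP p) (svalP q)).

Definition perm_category : category.
Proof.
by refine (@Category perm (fun=> perm_id) (fun=> perm_id) perm_comp
  _ _ _ _ _ _ _ _ _) => // *; apply: perm_eq.
Defined.

Lemma perm_groupoid : groupoid perm_category.
Proof.
move=> p; have [g pK gK] := svalP p.
have g_bij : bijective g by exists (sval p).
by exists (exist _ g g_bij); split=> //; apply: perm_eq; apply/funext.
Qed.

End PermutationCategory.

Theorem theorem6p8 (C : category) (C_rees : rees C) (C_skel : skeletal C) :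
  injective (canonical_functor C).
Proof.
have [Psi PsiP] := choice (arrow_extension C_rees C_skel).
have Psi_bij x : bijective (Psi x) by case: (PsiP x).
have Psi_point x c := let: And3 _ H _ := PsiP x in H c.
have Psi_act x h k s := let: And3 _ _ H := PsiP x in H h k s.
have [rep [repP rep_eq]] : exists rep : C -> C,
    (forall x, double_coset x (rep x)) /\
    (forall x y, double_coset x y -> rep x = rep y).
  have [[x0]|C0] := EM (exists x : C, True); last first.
    by exists id; split=> x; case: C0; exists x.
  (* Selecting from the coset as a set makes [rep] constant on it. *)
  have [rho rhoP] := set_selector x0.
  exists (fun x => rho (double_coset x)); split=> [x|x y xy].
    exact: rhoP (double_coset_refl x).
  by rewrite (double_coset_eq xy).
have [act actP] := choice (@acts_total _ C_rees C_skel Psi rep repP rep_eq).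
have actE a f : acts Psi rep a f -> act a = f.
  exact: (acts_functional C_rees C_skel Psi_act rep_eq (actP a)).
have act_dom a : act (dom a) = id.
  rewrite -(unit_act_dom a); apply: actE; apply: acts_unit.
  exact: invertible_dom.
pose F0 a : perm_category _ :=
  exist _ (act a) (acts_bij C_skel Psi_bij (actP a)).
have F_dom a : F0 (dom a) = dom (F0 a) by apply: perm_eq => /=.
have F_cod a : F0 (cod a) = cod (F0 a).
  by apply: perm_eq; rewrite /= -dom_cod.
have F_mul a b : cod a = dom b -> F0 (mul a b) = mul (F0 a) (F0 b).
  by move=> ab; apply: perm_eq; apply: actE; apply: acts_mul.
(* Arrows identified in the universal groupoid must act by the same permutation. *)
have [H [HF _]] := canonical_functor_universal (Functor F_dom F_cod F_mul)
  (@perm_groupoid _).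
move=> a b ab; have act_ab : act a = act b.
  by have := congr1 (fun u => sval (H u)) ab; rewrite !HF.
(* The congruence preserves endpoints, so [a] and [b] are parallel; a one-object target cannot
   detect this. *)
have /path_classP/(cong_parallel (@groupoid_rel_parallel C))[dab cab] := ab.
have {}dab : dom a = dom b by have [] := dab.
have {}cab : cod a = cod b by have [] := cab.
have act_cod c : act c (point_of (cod c)) = point_of c.
  by rewrite (acts_point C_skel Psi_point (actP c)) ?dom_cod ?mul_cod.
(* Evaluate the common permutation at the point of the common codomain. *)
have := act_cod a; rewrite act_ab cab act_cod => /(congr1 fst)/esym.
exact: sec_single_inj.
Qed.
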